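(* Let $M\subset\mathbb{R}^{2d}$ satisfy the standing assumptions below, let $T$ be its outer symplectic billiard map and $H$ the function defined below, and write $|x|_H:=H(x)$. There exist constants $\Lambda>0$ and $\bar C>0$, depending only on $M$, such that for every $x$ with $|x|_H\ge\Lambda$ and every integer $k\ge1$, $$\big|\,|T^{2k}(x)|_H^2-|x|_H^2\,\big|\le \bar C\,k.$$
   Context: Equip $\mathbb{R}^{2d}$ with the standard inner product, norm $|\cdot|$, complex structure $J$ ($J^2=-I$, orthogonal) and symplectic form $\omega(u,v)=\langle Ju,v\rangle$. Standing assumptions: $M\subset\mathbb{R}^{2d}$ is a smooth closed hypersurface bounding a strictly convex domain containing the origin in its interior, and $M$ is a level set of a smooth function with positive definite Hessian. For a hypersurface $Q$ of this kind and $q\in Q$, the Reeb vector $R_Q(q)$ is the unique vector with $\omega(v,R_Q(q))=0$ for all $v\in T_qQ$ and $\omega(q,R_Q(q))=1$; the symplectic polar is $Q^*=\{R_Q(q):q\in Q\}$. Write $a\sim b$ if $a=\lambda b$, $\lambda>0$. For $x$ in the exterior of $M$ let $m_-(x)\in M$ be the unique point with $m_-(x)-x\sim R_M(m_-(x))$, and $T(x)=2m_-(x)-x$ (outer symplectic billiard map). Let $\overline M$ be the symmetrization of $M$, i.e. the boundary of the Minkowski sum of the domain bounded by $M$ and its reflection in the origin (support function $p(v)+p(-v)$ if $p$ is that of $M$), and $N=(\overline M)^*$. Let $H$ be the positively $1$-homogeneous function with $N=\{H=1\}$; it is a norm on $\mathbb{R}^{2d}$. *)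

(* Defs.v *)
From HB Require Import structures.
From mathcomp Require Import all_boot all_order all_algebra.
From mathcomp Require Import all_classical all_reals all_analysis.
Set Implicit Arguments. Unset Strict Implicit. Unset Printing Implicit Defensive.
Import Order.TTheory GRing.Theory Num.Theory.
Import numFieldNormedType.Exports.
Local Open Scope classical_set_scope.
Local Open Scope ring_scope.

Section SymplecticDefs.
Variables (R : realType) (d : nat).

(* R^{2d} as row vectors of length d + d : coordinates (x_1..x_d, y_1..y_d) *)
Definition vec := 'rV[R]_(d + d).

Definition inner (u v : vec) : R := \sum_(i < d + d) u ord0 i * v ord0 i.

Definition Jc (u : vec) : vec := row_mx (- rsubmx u) (lsubmx u).

Definition omega (u v : vec) : R := inner (Jc u) v.

Fixpoint iter_dir (vs : seq vec) (f : vec -> R) : vec -> R :=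
  match vs with
  | [::] => f
  | v :: vs' => fun x => 'D_v (iter_dir vs' f) x
  end.

Definition smooth_on (U : set vec) (f : vec -> R) : Prop :=
  forall (vs : seq vec) (x : vec), U x -> differentiable (iter_dir vs f) x.

Definition hessian_posdef (f : vec -> R) (x : vec) : Prop :=
  forall v : vec, v != 0 -> 0 < 'D_v ('D_v f) x.

Definition boundary (A : set vec) : set vec := closure A `\` interior A.

Definition tangent (Q : set vec) (q v : vec) : Prop :=
  exists gam : R -> vec, gam 0 = q /\ (\forall t \near (0 : R), Q (gam t)) /\
    derivable gam 0 1 /\ 'D_1 gam 0 = v.

Definition is_reeb (Q : set vec) (q r : vec) : Prop :=
  (forall v, tangent Q q v -> omega v r = 0) /\ omega q r = 1.

Definition reeb (Q : set vec) (q : vec) : vec := xget 0 (is_reeb Q q).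

Definition sympl_polar (Q : set vec) : set vec := [set reeb Q q | q in Q].

Definition m_minus (M : set vec) (x : vec) : vec :=
  xget 0 [set m | M m /\ exists2 lam : R, 0 < lam & m - x = lam *: reeb M m].

Definition outer_billiard (M : set vec) (x : vec) : vec :=
  2%:R *: m_minus M x - x.

Definition diff_body (K : set vec) : set vec :=
  [set a - b | a in K & b in K].

(* symmetrization of M = boundary of K + (-K), K the domain bounded by M *)
Definition symmetrization (K : set vec) : set vec := boundary (diff_body K).

End SymplecticDefs.

(* Main.v *)
Require Import Defs.
From HB Require Import structures.
From mathcomp Require Import all_boot all_order all_algebra.
From mathcomp Require Import all_classical all_reals all_analysis.
From mathcomp Require Import lra ring.
Import Order.TTheory GRing.Theory Num.Theory.
Import numFieldNormedType.Exports.
Local Open Scope classical_set_scope.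
Local Open Scope ring_scope.

(** Two steps of the billiard translate [x] by [2 *: (m2 - m1)], where [m1] and [m2]
    maximise the linear forms [<., J (x - m1)>] and [<., - J (x + m2 - 2 m1)>] on the
    body [K].  The norm [H] is the width [H x = max_(a, b in K) <a - b, J x>], a
    convex function with subgradient [- J (a - b)] at [x] for maximisers [a, b].
    The positive Hessian and compactness make [K] uniformly convex, so its support
    points depend on the direction in a Lipschitz way, and [m1 - m2] is within
    [O(1/|x|)] of [a - b].  As [<w, J w> = 0], convexity of [H] at [x] and at
    [T (T x)] bounds the change of [H] by [O(1/|x|)], and that of [H ^ 2] by [O(1)];
    for bounded [x] the latter is trivial because [m1] and [m2] stay in [K].  The
    bound is then summed along the orbit.

    To identify [H] with the width one needs the Reeb vectors of the boundaries of
    [K] and [K - K].  At a boundary point of [K] the level set stays locally strictly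
    below the tangent hyperplane of [F], which forces [grad F] to be the outer normal
    of [K] there and the tangent cone of [K] to be a half-space; both properties pass
    to [K - K], and they determine the Reeb vector. *)

Set Implicit Arguments.
Unset Strict Implicit.
Unset Printing Implicit Defensive.

Lemma iter_dist_le (R : numDomainType) (V : normedZmodType R) (T : Type)
    (S : T -> T) (f : T -> V) (C : R) (x : T) (k : nat) :
  (forall y, `|f (S y) - f y| <= C) -> `|f (iter k S x) - f x| <= C * k%:R.
Proof.
move=> fS; elim: k => [|k IHk]; first by rewrite subrr normr0 mulr0.
rewrite iterS -(subrK (f (iter k S x)) (f (S _))) -addrA mulrSr mulrDr mulr1.
by rewrite addrC; apply: le_trans (ler_normD _ _) _; exact: lerD.
Qed.

Section InnerProduct.
Variables (R : realType) (d : nat).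
Implicit Types u v w : vec R d.

Lemma innerC u v : inner u v = inner v u.
Proof. by apply: eq_bigr => i _; rewrite mulrC. Qed.

Lemma innerDl u v w : inner (u + v) w = inner u w + inner v w.
Proof. by rewrite -big_split; apply: eq_bigr => i _; rewrite mxE mulrDl. Qed.

Lemma innerZl (t : R) u v : inner (t *: u) v = t * inner u v.
Proof. by rewrite mulr_sumr; apply: eq_bigr => i _; rewrite mxE mulrA. Qed.

Lemma innerDr u v w : inner u (v + w) = inner u v + inner u w.
Proof. by rewrite innerC innerDl !(innerC u). Qed.

Lemma innerZr (t : R) u v : inner u (t *: v) = t * inner u v.
Proof. by rewrite innerC innerZl innerC. Qed.

Lemma innerNl u v : inner (- u) v = - inner u v.
Proof. by rewrite -scaleN1r innerZl mulN1r. Qed.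

Lemma innerNr u v : inner u (- v) = - inner u v.
Proof. by rewrite innerC innerNl innerC. Qed.

Lemma inner0l u : inner 0 u = 0.
Proof. by rewrite -(scale0r 0) innerZl mul0r. Qed.

Lemma inner0r u : inner u 0 = 0.
Proof. by rewrite innerC inner0l. Qed.

Definition innerE :=
  (innerDl, innerDr, innerNl, innerNr, innerZl, innerZr, inner0l, inner0r).

Lemma inner_gt0 u : u != 0 -> 0 < inner u u.
Proof.
move=> u0; rewrite lt_neqAle sumr_ge0 ?andbT; last first.
  by move=> i _; rewrite -expr2 sqr_ge0.
apply: contra u0; rewrite eq_sym psumr_eq0; last first.
  by move=> i _; rewrite -expr2 sqr_ge0.
move=> /allP u0; apply/eqP/rowP => i; rewrite mxE.
by have := u0 i (mem_index_enum _); rewrite /= mulf_eq0 orbb => /eqP.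
Qed.

Lemma inner_eq0 u : inner u u = 0 -> u = 0.
Proof. by move=> u0; apply/eqP; apply: contraPT u0 => /inner_gt0/gt_eqF/eqP. Qed.

Lemma normv_le (r : R) u : 0 <= r -> (forall i, `|u ord0 i| <= r) -> `|u| <= r.
Proof.
move=> r0 ur; rewrite /Num.Def.normr/= mx_normrE.
by apply: (bigmax_le _ r0) => -[i j] _ /=; rewrite (ord1 i).
Qed.

Lemma coord_le_normv u i : `|u ord0 i| <= `|u|.
Proof.
rewrite [leRHS]/Num.Def.normr/= mx_normrE.
by apply/bigmax_geP; right => /=; exists (ord0, i).
Qed.

Lemma inner_le_normv u v : `|inner u v| <= (d + d)%:R * `|u| * `|v|.
Proof.
apply: le_trans (ler_norm_sum _ _ _) _.
apply: le_trans (_ : \sum_(i < d + d) `|u| * `|v| <= _).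
  by apply: ler_sum => i _; rewrite normrM ler_pM// coord_le_normv.
by rewrite sumr_const card_ord -[X in X <= _]mulr_natl mulrA.
Qed.

Lemma cvg_coord (T : Type) (G : set_system T) {FG : Filter G}
    (f : T -> vec R d) u i :
  f t @[t --> G] --> u -> f t ord0 i @[t --> G] --> u ord0 i.
Proof.
move=> fu.
exact: (cvg_comp f (fun v : vec R d => v ord0 i) fu (@coord_continuous _ _ _ _ _ _)).
Qed.

Lemma cvg_inner (T : Type) (G : set_system T) {FG : Filter G}
    (f g : T -> vec R d) u v :
  f t @[t --> G] --> u -> g t @[t --> G] --> v ->
  inner (f t) (g t) @[t --> G] --> inner u v.
Proof.
move=> fu gv; apply: (cvg_big add_continuous) => i _.
by apply: cvgM; exact: cvg_coord.
Qed.

Lemma inner_continuous v : continuous (fun u : vec R d => inner u v).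
Proof. by move=> u; exact: (cvg_inner (@cvg_id _ (nbhs u)) (@cvg_cst _ v _ _ _)). Qed.

Lemma is_derive_innerl (g : R -> vec R d) n (t : R) : derivable g t 1 ->
  is_derive t 1 (fun s => inner (g s) n) (inner ('D_1 g t) n).
Proof.
move=> gt; have gn_cvg : h^-1 *: (inner (g (h *: 1 + t)) n - inner (g t) n)
    @[h --> (0 : R)^'] --> inner ('D_1 g t) n.
  have -> : (fun h : R => h^-1 *: (inner (g (h *: 1 + t)) n - inner (g t) n)) =
      (fun h : R => inner (h^-1 *: (g (h *: 1 + t) - g t)) n).
    by apply/funext => h; rewrite !innerE.
  exact: (cvg_inner gt (@cvg_cst _ n _ _ _)).
by split; [exact: cvgP gn_cvg | exact: cvg_lim gn_cvg].
Qed.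

Lemma JcD u v : Jc (u + v) = Jc u + Jc v.
Proof. by rewrite /Jc add_row_mx !linearD. Qed.

Lemma JcZ (t : R) u : Jc (t *: u) = t *: Jc u.
Proof. by rewrite /Jc scale_row_mx scalerN !linearZ. Qed.

Lemma JcN u : Jc (- u) = - Jc u.
Proof. by rewrite -scaleN1r JcZ scaleN1r. Qed.

Definition JcE := (JcD, JcZ, JcN).

Lemma JcK u : Jc (Jc u) = - u.
Proof. by rewrite /Jc row_mxKl row_mxKr -opp_row_mx hsubmxK. Qed.

Lemma inner_Jc u v : inner (Jc u) (Jc v) = inner u v.
Proof.
rewrite /inner !big_split_ord /= addrC; congr (_ + _); apply: eq_bigr => i _.
- by rewrite /Jc !row_mxEr !mxE.
- by rewrite /Jc !row_mxEl !mxE mulrNN.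
Qed.

Lemma inner_Jcl u v : inner (Jc u) v = - inner u (Jc v).
Proof. by rewrite -[LHS]inner_Jc JcK innerNl. Qed.

Lemma inner_Jc_self u : inner u (Jc u) = 0.
Proof. by have := inner_Jcl u u; rewrite innerC; lra. Qed.

Lemma normv_Jc u : `|Jc u| = `|u|.
Proof.
have le_J v : `|Jc v| <= `|v|.
  apply: normv_le => // i; rewrite /Jc; case: (split_ordP i) => j ->.
  - by rewrite row_mxEl !mxE normrN coord_le_normv.
  - by rewrite row_mxEr !mxE coord_le_normv.
by apply/le_anti; rewrite le_J/= -[leLHS]normrN -JcK le_J.
Qed.

Lemma Jc_eq0 u : (Jc u == 0) = (u == 0).
Proof. by rewrite -normr_eq0 normv_Jc normr_eq0. Qed.

End InnerProduct.

Section Calculus.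
Variable R : realType.

Lemma ball_segment (V : normedModType R) (m x y : V) (r t : R) :
  ball m r x -> ball m r y -> 0 <= t <= 1 -> ball m r (x + t *: (y - x)).
Proof.
rewrite -!ball_normE /= => mx my /andP[t0 t1].
have -> : m - (x + t *: (y - x)) = (1 - t) *: (m - x) + t *: (m - y).
  have -> : y - x = (m - x) - (m - y) by rewrite opprB [RHS]addrC addrA subrK.
  by rewrite opprD addrA scalerBr opprB addrA addrAC scalerBl scale1r.
apply: le_lt_trans (ler_normD _ _) _; rewrite !normrZ !ger0_norm ?subr_ge0//.
have [t_small|t_big] := leP t (1 / 2).
  have := ler_wpM2l t0 (ltW my).
  have := mx; rewrite -(ltr_pM2l (_ : 0 < 1 - t)); lra.
have := ler_wpM2l (_ : 0 <= 1 - t) (ltW mx).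
by have := my; rewrite -(ltr_pM2l (_ : 0 < t)); lra.
Qed.

Lemma cvg_line (V : normedModType R) (x v : V) (t : R) :
  (x + s *: v) @[s --> t] --> x + t *: v.
Proof. by apply: cvgD; [exact: cvg_cst | exact: cvgZr_tmp]. Qed.

Lemma near_line (V : normedModType R) (A : set V) (x v : V) :
  nbhs x A -> \forall t \near (0 : R), A (x + t *: v).
Proof. by move=> xA; apply: (@cvg_line _ x v 0); rewrite scale0r addr0. Qed.

Lemma derive_lt0_near (V : normedModType R) (f : V -> R) (x v : V) :
  derivable f x v -> 'D_v f x < 0 ->
  \forall t \near (0 : R)^'+, f (x + t *: v) < f x.
Proof.
move=> fv fv0; have fcvg := cvg_dnbhs_at_right fv.
have : \forall t \near (0 : R)^'+, t^-1 *: (f (t *: v + x) - f x) < 0.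
  exact: (cvgr_lt _ fcvg).
apply: filterS2 (nbhs_right_gt (0 : R)) => t t0.
by rewrite pmulr_rlt0 ?invr_gt0// subr_lt0 /= addrC.
Qed.

Lemma derive_local_max (V : normedModType R) (f : V -> R) (x v : V) :
  derivable f x v ->
  (\forall t \near (0 : R), f (x + t *: v) <= f x) -> 'D_v f x = 0.
Proof.
move=> fv fmax; apply/le_anti/andP; split.
- apply: (cvgr_to_le (cvg_dnbhs_at_right fv)); near=> t.
  rewrite mulr_ge0_le0 ?invr_ge0// subr_le0 /= addrC.
  by near: t; exact: cvg_within fmax.
- apply: (cvgr_to_ge (cvg_dnbhs_at_left fv)); near=> t.
  rewrite mulr_le0 ?invr_le0// subr_le0 /= addrC.
  by near: t; exact: cvg_within fmax.
Unshelve. all: by end_near. Qed.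

Lemma is_derive_line (V W : normedModType R) (f : V -> W) (x v : V) (t : R) :
  differentiable f (x + t *: v) ->
  is_derive t 1 (fun s : R => f (x + s *: v)) ('D_v f (x + t *: v)).
Proof.
move=> fx.
have lineE : (fun h : R => h^-1 *: (f (x + (h *: (1 : R) + t) *: v) -
    f (x + t *: v))) =
  (fun h : R => h^-1 *: (f (h *: v + (x + t *: v)) - f (x + t *: v))).
  apply/funext => h; congr (_ *: (f _ - _)).
  by rewrite scalerDl [_ *: 1]mulr1 addrCA.
have fv : derivable f (x + t *: v) v by exact: diff_derivable.
by split; move: fv; rewrite /derivable /derive /= lineE.
Qed.

Lemma second_order_lower_bound (f f1 f2 : R -> R) (a b k : R) : a <= b ->
  (forall t : R, a <= t <= b -> is_derive t 1 f (f1 t)) ->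
  (forall t : R, a <= t <= b -> is_derive t 1 f1 (f2 t)) ->
  (forall t : R, a <= t <= b -> 2 * k <= f2 t) ->
  f a + f1 a * (b - a) + k * (b - a) ^+ 2 <= f b.
Proof.
move=> ab f'E f1'E kf2.
pose g t := f t - k * (t - a) ^+ 2.
have g'E (t : R) : a <= t <= b -> is_derive t 1 g (f1 t - 2 * k * (t - a)).
  move=> tab; have ? := f'E t tab; apply: is_derive_eq.
  by rewrite /GRing.scale /= !(expr1, mulr1, scale0r, add0r, addr0, subr0); ring.
have [||c cab] := @MVT_segment R g (fun t => f1 t - 2 * k * (t - a)) a b ab.
- by move=> s /itvP sab; apply: g'E; rewrite !sab.
- apply/derivable_within_continuous => s /itvP sab.
  by have [] := g'E s; rewrite ?sab.
have ac : a <= c by rewrite (itvP cab).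
have cb : c <= b by rewrite (itvP cab).
have [||e eac] := @MVT_segment R f1 f2 a c ac.
- by move=> s /itvP sac; apply: f1'E; rewrite sac (le_trans _ cb)// sac.
- apply/derivable_within_continuous => s /itvP sac.
  by have [] := f1'E s; rewrite ?sac ?(le_trans _ cb)// sac.
move=> f1c; rewrite /g subrr expr0n mulr0 subr0 => gb.
have : 2 * k <= f2 e by apply: kf2; rewrite (itvP eac) (le_trans _ cb)// (itvP eac).
move=> /(ler_wpM2r (_ : 0 <= c - a)); rewrite subr_ge0 -f1c => /(_ ac) f1ge.
have /ler_wpM2r/(_ (f1 a) (f1 c - 2 * k * (c - a))) : 0 <= b - a by rewrite subr_ge0.
by lra.
Qed.

End Calculus.

Section SmoothFunction.
Variables (R : realType) (d : nat).
Implicit Types (B U : set (vec R d)) (F : vec R d -> R) (u v x y : vec R d).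

Definition grad F x : vec R d := \row_i 'D_(delta_mx ord0 i) F x.

Lemma derive_grad F x v : differentiable F x -> 'D_v F x = inner (grad F x) v.
Proof.
move=> Fx; rewrite deriveE// {1}(row_sum_delta v) linear_sum.
by apply: eq_bigr => i _; rewrite linearZ/= mxE deriveE// mulrC.
Qed.

Lemma smooth_on_differentiable U F x : smooth_on U F -> U x -> differentiable F x.
Proof. by move=> /(_ [::] x). Qed.

Lemma smooth_on_derive U F v : smooth_on U F -> smooth_on U ('D_v F).
Proof.
move=> sF vs x /(sF (rcons vs v)).
suff -> : iter_dir (rcons vs v) F = iter_dir vs ('D_v F) by [].
by elim: vs => //= u vs ->.
Qed.

Lemma grad_continuous U F x : smooth_on U F -> U x -> {for x, continuous (grad F)}.
Proof.
move=> sF Ux.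
have -> : grad F = fun y => \sum_i 'D_(delta_mx ord0 i) F y *: delta_mx ord0 i.
  apply/funext => y; rewrite [LHS]row_sum_delta.
  by apply: eq_bigr => i _; rewrite mxE.
apply: (cvg_big add_continuous (@nbhs_filter _ x)) => i _; apply: cvgZr_tmp.
exact: (differentiable_continuous
  (smooth_on_differentiable (smooth_on_derive _ sF) Ux)).
Qed.

Definition hess_form F x v : R :=
  \sum_i v ord0 i * inner (grad ('D_(delta_mx ord0 i) F) x) v.

Lemma derive2_hess_form U F x v : open U -> smooth_on U F -> U x ->
  'D_v ('D_v F) x = hess_form F x v.
Proof.
move=> oU sF Ux; have diffD u : differentiable ('D_u F) x.
  exact: smooth_on_differentiable (smooth_on_derive _ sF) Ux.
have DvE : \forall y \near x,
    'D_v F y = (\sum_i (v ord0 i *: 'D_(delta_mx ord0 i) F)) y.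
  near=> y; rewrite derive_grad; last first.
    by apply: (smooth_on_differentiable sF); near: y; exact: open_nbhs_nbhs.
  by rewrite fct_sumE; apply: eq_bigr => i _; rewrite mxE mulrC.
rewrite (near_eq_derive _ DvE) derive_sum; last first.
  by move=> i; exact/derivableZ/diff_derivable.
apply: eq_bigr => i _; rewrite deriveZ; last exact: diff_derivable.
by rewrite derive_grad.
Unshelve. all: by end_near. Qed.

Lemma hess_formZ F x (t : R) v : hess_form F x (t *: v) = t ^+ 2 * hess_form F x v.
Proof. by rewrite mulr_sumr; apply: eq_bigr => i _; rewrite mxE innerZr; ring. Qed.

Lemma cvg_hess_form U F x v (T : Type) (G : set_system T) {FG : Filter G}
    (f g : T -> vec R d) : smooth_on U F -> U x ->
  f t @[t --> G] --> x -> g t @[t --> G] --> v ->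
  hess_form F (f t) (g t) @[t --> G] --> hess_form F x v.
Proof.
move=> sF Ux fx gv; apply: (cvg_big add_continuous) => i _; apply: cvgM.
  exact: cvg_coord.
apply: cvg_inner gv; move: fx => /cvg_comp; apply.
exact: grad_continuous (smooth_on_derive _ sF) Ux.
Qed.

Lemma unit_sphere_compact : compact [set v : vec R d | `|v| = 1].
Proof.
apply: bounded_closed_compact.
  by exists 1; split => // M M1 v /= ->; exact: ltW.
apply: (@closed_comp _ _ (fun v : vec R d => `|v|) [set 1]).
  by move=> v _; exact: norm_continuous.
exact: closed_eq.
Qed.

Lemma hess_form_lower_sphere U F x : open U -> smooth_on U F -> U x ->
  hessian_posdef F x ->
  exists2 k : R, 0 < k &
    \forall y \near x, forall v, `|v| = 1 -> k <= hess_form F y v.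
Proof.
move=> oU sF Ux posF; pose G := filter_prod (nbhs x) ((0 : R)^'+).
have /compact_near_coveringP/(_ _ G (fun p v => p.2 < hess_form F p.1 v) _) :=
  unit_sphere_compact.
case=> [v v1|[A B] /= [xA B0] AB].
  have hv : 0 < hess_form F x v.
    rewrite -(derive2_hess_form _ oU sF Ux); apply: posF; apply/eqP => v0.
    by move: v1; rewrite /= v0 normr0 => /eqP; rewrite eq_sym oner_eq0.
  have xcvg : z.2.1 @[z --> filter_prod (nbhs v) G] --> x.
    exact: (cvg_comp snd fst (@cvg_snd _ _ _ _ _) (@cvg_fst _ _ _ _ _)).
  have kcvg : z.2.2 @[z --> filter_prod (nbhs v) G] --> (0 : R).
    apply: (cvg_comp snd snd (@cvg_snd _ _ _ _ _)).
    by apply: (cvg_trans (@cvg_snd _ _ _ _ _)); exact: cvg_within.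
  have hcvg : hess_form F z.2.1 z.1 - z.2.2 @[z --> filter_prod (nbhs v) G] -->
      hess_form F x v.
    rewrite -[X in _ --> X]subr0; apply: cvgB kcvg.
    exact: (cvg_hess_form sF Ux xcvg (@cvg_fst _ _ _ _ _)).
  have : \forall z \near filter_prod (nbhs v) G,
      0 < hess_form F z.2.1 z.1 - z.2.2 by exact: (cvgr_gt _ hcvg).
  by apply: filterS => z /=; rewrite subr_gt0.
have : \forall k \near (0 : R)^'+, 0 < k /\ B k.
  by near=> k; split; [near: k; exact: nbhs_right_gt | near: k].
move=> /filter_ex[k [k0 Bk]]; exists k => //.
by apply: filterS xA => y Ay v v1; apply/ltW/(AB (y, k)).
Unshelve. all: by end_near. Qed.

Lemma hess_form_lower_near U F x : open U -> smooth_on U F -> U x ->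
  hessian_posdef F x ->
  exists2 k : R, 0 < k &
    \forall y \near x, forall v, k * `|v| ^+ 2 <= hess_form F y v.
Proof.
move=> oU sF Ux /(hess_form_lower_sphere oU sF Ux)[k k0 hk].
exists k => //; apply: filterS hk => y hy v.
have [->|v0] := eqVneq v 0.
  rewrite normr0 expr0n mulr0 -[X in hess_form F y X](scale0r (0 : vec R d)).
  by rewrite hess_formZ expr0n mul0r.
have nv : 0 < `|v| by rewrite normr_gt0.
have := hy (`|v|^-1 *: v); rewrite hess_formZ exprVn ler_pdivlMl ?exprn_gt0//.
by rewrite mulrC; apply; rewrite normrZ normfV normr_id mulVf ?gt_eqF.
Qed.

Definition strongly_convex_on B F (k : R) := forall x y, B x -> B y ->
  F x + inner (grad F x) (y - x) + k * `|y - x| ^+ 2 <= F y.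

Lemma strongly_convex_near U F x0 : open U -> smooth_on U F -> U x0 ->
  hessian_posdef F x0 ->
  exists k r : R, [/\ 0 < k, 0 < r & strongly_convex_on (ball x0 r) F k].
Proof.
move=> oU sF Ux0 posF; have [k k0 hk] := hess_form_lower_near oU sF Ux0 posF.
have : \forall y \near x0, U y /\ forall v, k * `|v| ^+ 2 <= hess_form F y v.
  by near=> y; split; near: y => //; exact: open_nbhs_nbhs.
move=> /nbhs_ballP[r /= r0 Ur]; exists (k / 2), r; split; rewrite ?divr_gt0//.
move=> x y xr yr; set v := y - x.
have line t : 0 <= t <= 1 ->
    U (x + t *: v) /\ forall w, k * `|w| ^+ 2 <= hess_form F (x + t *: v) w.
  by move=> t01; have [] := Ur _ (ball_segment xr yr t01).
have := @second_order_lower_bound R (fun t => F (x + t *: v))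
  (fun t => 'D_v F (x + t *: v)) (fun t => 'D_v ('D_v F) (x + t *: v)) 0 1
  (k / 2 * `|v| ^+ 2) ler01.
rewrite scale0r addr0 scale1r [x + v]addrC subrK subr0 expr1n !mulr1.
rewrite derive_grad; last by apply: smooth_on_differentiable sF _; case: (Ur x xr).
apply=> t /line[Ut ht].
- exact/is_derive_line/(smooth_on_differentiable sF).
- exact/is_derive_line/(smooth_on_differentiable (smooth_on_derive _ sF)).
- by rewrite (derive2_hess_form _ oU sF Ut); have := ht v; lra.
Unshelve. all: by end_near. Qed.

End SmoothFunction.

Section Convexity.
Variable R : realType.

Lemma convex_segment (V : lmodType R) (D : set V) (a b : V) (t : R) :
  convex_set D -> D a -> D b -> 0 <= t <= 1 -> D (a + t *: (b - a)).
Proof.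
move=> convD /mem_set Da /mem_set Db /andP[t0 t1].
have := convD b a (Itv01 t0 t1) Db Da; rewrite inE.
have -> // : a + t *: (b - a) = t *: b + (1 - t) *: a.
by rewrite scalerBr scalerBl scale1r addrCA.
Qed.

Lemma segment_convex (V : lmodType R) (D : set V) :
  (forall a b (t : R), D a -> D b -> 0 <= t <= 1 -> D (a + t *: (b - a))) ->
  convex_set D.
Proof.
move=> Dseg a b t /set_mem Da /set_mem Db; apply/mem_set.
have := Dseg b a t%:num Db Da; rewrite ge0 le1 => /(_ isT).
by rewrite scalerBr addrCA -[b in b - _]scale1r -scalerBl.
Qed.

Lemma convex_interior_segment (V : normedModType R) (D : set V) (a b : V) (t : R) :
  convex_set D -> interior D a -> D b -> 0 <= t < 1 ->
  interior D (a + t *: (b - a)).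
Proof.
move=> convD /nbhs_ballP[r /= r0 Dr] Db /andP[t0 t1].
have t10 : 0 < 1 - t by lra.
apply/nbhs_ballP; exists ((1 - t) * r) => /= [|z]; first exact: mulr_gt0.
rewrite -ball_normE /= => zr; pose a' := (1 - t)^-1 *: (z - t *: b).
have a'E : (1 - t) *: a' = z - t *: b.
  by rewrite /a' scalerA divff ?gt_eqF// scale1r.
have zE : z = a' + t *: (b - a').
  have -> : a' + t *: (b - a') = t *: b + (1 - t) *: a'.
    by rewrite scalerBr scalerBl scale1r addrCA.
  by rewrite a'E addrC subrK.
have aE : (1 - t) *: (a - a') = a + t *: (b - a) - z.
  rewrite scalerBr a'E scalerBl scale1r opprB scalerBr.
  by rewrite addrA (addrA a) (addrAC a (t *: b)).
rewrite zE; apply: convex_segment => //; last by rewrite t0 ltW.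
apply: Dr; rewrite -ball_normE /= -(ltr_pM2l t10); apply: le_lt_trans zr.
by rewrite -aE normrZ (gtr0_norm t10).
Qed.

End Convexity.

Section ConvexSets.
Variables (R : realType) (d : nat).
Implicit Types (D Q : set (vec R d)) (a b m n p q u v w y z : vec R d) (r s t : R).

Lemma boundary_closed D y : closed D -> boundary D y <-> D y /\ ~ interior D y.
Proof. by move=> /closure_id {2}->. Qed.

Lemma segment_meets_boundary D a b : closed D -> interior D a -> ~ interior D b ->
  exists2 t, 0 < t <= 1 & boundary D (a + t *: (b - a)).
Proof.
move=> cD Da nDb; apply: contrapT => nbd; apply: nDb.
pose l t := a + t *: (b - a).
have lc : continuous l by move=> t; exact: cvg_line.
have nbd_l t : 0 <= t <= 1 -> ~ boundary D (l t).
  move=> /andP[t0 t1] bt; apply: nbd; exists t => //; rewrite t1 andbT lt_neqAle t0.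
  rewrite andbT; apply/eqP => t_eq0; move: bt; rewrite /l -t_eq0 scale0r addr0.
  by move=> /boundary_closed-/(_ cD)[].
have intE : `[0, 1]%classic `&` l @^-1` (interior D) = `[0, 1]%classic `&` l @^-1` D.
  apply/seteqP; split=> t [/= t01]; first by move=> /interior_subset.
  move=> Dt; split => //; apply: contrapT => nDt; move: t01; rewrite in_itv/=.
  by move=> /nbd_l; apply; apply/boundary_closed.
have allE : `[0, 1]%classic `&` l @^-1` (interior D) = `[0, 1]%classic.
  apply: segment_connected.
  - by exists 0; split; rewrite /= ?in_itv/= ?lexx ?ler01// /l scale0r addr0.
  - exists (l @^-1` (interior D)) => //.
    by apply: open_comp (open_interior _) => t _; exact: lc.
  - by exists (l @^-1` D) => //; apply: preimage_closed cD => t _; exact: lc.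
have : (`[0, 1]%classic : set R) 1 by rewrite /= in_itv/= ler01 lexx.
by rewrite -allE => -[_]; rewrite /l /= scale1r addrC subrK.
Qed.

Definition outer_normal D m n := forall y, D y -> inner y n <= inner m n.

Lemma outer_normalZ D m n t : 0 <= t -> outer_normal D m n ->
  outer_normal D m (t *: n).
Proof. by move=> t0 mn y /mn yn; rewrite !innerZr ler_wpM2l. Qed.

Lemma outer_normal_interior_lt D m n y : outer_normal D m n -> n != 0 ->
  interior D y -> inner y n < inner m n.
Proof.
move=> mn n0 Dy; near (0 : R)^'+ => t.
have t0 : 0 < t by near: t; exact: nbhs_right_gt.
have /mn : D (y + t *: n) by near: t; exact: cvg_within (near_line n Dy).
by rewrite innerDl innerZl; have := mulr_gt0 t0 (inner_gt0 n0); lra.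
Unshelve. all: by end_near. Qed.

Lemma outer_normal_inner_gt0 D m n : interior D 0 -> outer_normal D m n -> n != 0 ->
  0 < inner m n.
Proof.
by move=> D0 mn n0; have := outer_normal_interior_lt mn n0 D0; rewrite inner0l.
Qed.

Lemma outer_normal_boundary D m n : closed D -> D m -> n != 0 ->
  outer_normal D m n -> boundary D m.
Proof.
move=> cD Dm n0 mn; apply/boundary_closed => //; split => // im.
by have := outer_normal_interior_lt mn n0 im; rewrite ltxx.
Qed.

Lemma outer_normal_tangent D m n v : closed D -> outer_normal D m n ->
  tangent (boundary D) m v -> inner v n = 0.
Proof.
move=> cD mn [g [g0 [Dg [dg <-]]]].
have [dgn <-] := is_derive_innerl n dg; apply: derive_local_max dgn _.
rewrite g0; apply: filterS Dg => t /boundary_closed-/(_ cD)[/mn].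
by rewrite add0r [_ *: 1]mulr1.
Qed.

Lemma boundary_free_halfspace_interior D m n p v r : closed D ->
  (forall y, ball m r y -> boundary D y -> y != m -> inner y n < inner m n) ->
  interior D p -> ball m r p -> inner m n < inner p n ->
  ball m r (m + v) -> v != 0 -> inner v n = 0 -> interior D (m + v).
Proof.
move=> cD below Dp Bp mp Bv v0 vn; apply: contrapT.
move=> /(segment_meets_boundary cD Dp)[t /andP[t0 t1] bt].
have := below _ (ball_segment Bp Bv _) bt; rewrite (ltW t0) t1 => /(_ isT).
have [->|t1'] := eqVneq t 1.
  rewrite scale1r [p + _]addrC subrK addrC -subr_eq0 addrK => /(_ v0).
  by rewrite innerDl vn add0r ltxx.
pose u := (1 - t) *: (p - m) + t *: v.
have -> : p + t *: (m + v - p) = m + u by apply/rowP => i; rewrite !mxE; ring.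
have un : 0 < inner u n.
  rewrite innerDl !innerZl vn mulr0 addr0 mulr_gt0//.
    by rewrite subr_gt0 lt_neqAle t1'.
  by rewrite innerDl innerNl subr_gt0.
have u0 : u != 0 by apply: contraTneq un => ->; rewrite inner0l ltxx.
rewrite addrC -subr_eq0 addrK => /(_ u0).
by rewrite innerDl gtrDr ltNge ltW.
Qed.

Lemma interior_above_near D m n y r : convex_set D -> interior D !=set0 ->
  D m -> D y -> inner m n < inner y n -> 0 < r ->
  exists p, [/\ interior D p, ball m r p & inner m n < inner p n].
Proof.
move=> convD [p0 Dp0] Dm Dy my r0.
have above : \forall z \near y, inner m n < inner z n.
  exact: (cvgr_gt _ (@inner_continuous _ _ n y) _ my).
near (0 : R)^'+ => t; have t0 : 0 < t by near: t; exact: nbhs_right_gt.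
have t1 : t < 1 by near: t; exact: nbhs_right_lt.
pose p := y + t *: (p0 - y).
have pn : inner m n < inner p n.
  by rewrite /p; near: t; apply: cvg_within; exact: near_line above.
have Dp : interior D p.
  have -> : p = p0 + (1 - t) *: (y - p0) by apply/rowP => i; rewrite !mxE; ring.
  by apply: convex_interior_segment => //; lra.
near (0 : R)^'+ => s; have s0 : 0 < s by near: s; exact: nbhs_right_gt.
have s1 : s < 1 by near: s; exact: nbhs_right_lt.
exists (m + s *: (p - m)); split.
- have -> : m + s *: (p - m) = p + (1 - s) *: (m - p).
    by apply/rowP => i; rewrite !mxE; ring.
  by apply: convex_interior_segment => //; lra.
- by near: s; apply: cvg_within; apply: near_line; exact: nbhsx_ballx.
- by rewrite innerDl innerZl ltrDl mulr_gt0// innerDl innerNl subr_gt0.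
Unshelve. all: by end_near. Qed.

(* In dimension at least two, a half-ball without its center [m] is connected, so
   a half-space free of boundary points near [m] lies on one side of [D]; it cannot
   be the inner side, as two points symmetric about [m] would then be interior. *)
Lemma local_outer_normal D m n : closed D -> convex_set D -> interior D !=set0 ->
  boundary D m -> n != 0 ->
  (\forall y \near m, boundary D y -> y != m -> inner y n < inner m n) ->
  outer_normal D m n.
Proof.
move=> cD convD Dn0 /boundary_closed-/(_ cD)[Dm nDm] n0.
move=> /nbhs_ballP[r /= r0 below] y Dy; rewrite leNgt; apply/negP => my.
have [p [Dp Bp mp]] := interior_above_near convD Dn0 Dm Dy my r0.
have interior_off (e : R) : e != 0 -> ball m r (m + e *: Jc n) ->
    interior D (m + e *: Jc n).
  move=> e0 Be; apply: (boundary_free_halfspace_interior cD below Dp Bp mp Be).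
    by rewrite scaler_eq0 Jc_eq0 (negPf n0) (negPf e0).
  by rewrite innerZl innerC inner_Jc_self mulr0.
near (0 : R)^'+ => e; have e0 : 0 < e by near: e; exact: nbhs_right_gt.
have De : interior D (m + e *: Jc n).
  apply: interior_off; first by rewrite gt_eqF.
  by near: e; apply: cvg_within; apply: near_line; exact: nbhsx_ballx.
have DNe : interior D (m + (- e) *: Jc n).
  apply: interior_off; first by rewrite oppr_eq0 gt_eqF.
  rewrite scaleNr -scalerN; near: e; apply: cvg_within; apply: near_line.
  exact: nbhsx_ballx.
apply: nDm.
have -> : m = m + e *: Jc n + 2^-1 *: (m + (- e) *: Jc n - (m + e *: Jc n)).
  by apply/rowP => i; rewrite !mxE; field.
by apply: convex_interior_segment (interior_subset DNe) _ => //; lra.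
Unshelve. all: by end_near. Qed.

Lemma boundary_not_isolated D m : closed D -> convex_set D -> interior D 0 ->
  boundary D m -> ~ \forall y \near m, boundary D y -> y = m.
Proof.
move=> cD convD D0 bm iso; have [Dm nDm] := (boundary_closed m cD).1 bm.
have m0 : m != 0 by apply: contra_notN nDm => /eqP ->.
have normal n : n != 0 -> outer_normal D m n.
  move=> n0; apply: local_outer_normal => //; first by exists 0.
  by apply: filterS iso => y Dy /Dy ->; rewrite eqxx.
have := outer_normal_inner_gt0 D0 (normal m m0) m0.
have : 0 < inner m (- m).
  by apply: outer_normal_inner_gt0 D0 (normal _ _) _; rewrite oppr_eq0.
by rewrite innerNr; lra.
Qed.

Definition feasible D q u := \forall t \near (0 : R)^'+, D (q + t *: u).

(* The tangent cone of [D] at [q] is the whole half-space [inner u n <= 0]. *)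
Definition smooth_point D q n := [/\ D q, n != 0, outer_normal D q n &
  forall u, inner u n < 0 -> feasible D q u].

Lemma small_correction_tangent Q q w v (s : R -> R) :
  (\forall t \near (0 : R), Q (q + t *: v - s t *: w)) ->
  (forall e : R, 0 < e -> \forall t \near (0 : R), `|s t| <= e * `|t|) ->
  tangent Q q v.
Proof.
move=> Qs s_small; pose g t := q + t *: v - s t *: w.
have s0 : s 0 = 0.
  have := nbhs_singleton (s_small 1 ltr01).
  by rewrite normr0 mulr0 normr_le0 => /eqP.
have g0 : g 0 = q by rewrite /g s0 !scale0r addr0 subr0.
exists g; split => //; split => //.
suff g_cvg : h^-1 *: ((g \o shift 0) (h *: 1) - g 0) @[h --> (0 : R)^'] --> v.
  by split; [exact: cvgP g_cvg | exact: cvg_lim g_cvg].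
apply/cvgrPdist_le => e e0; near=> h.
have h0 : h != 0 by near: h; exact: nbhs_dnbhs_neq.
have sh : `|s h| <= e / (1 + `|w|) * `|h|.
  by near: h; apply: nbhs_dnbhs; apply: s_small; rewrite divr_gt0// ltr_pwDl.
rewrite g0 /= addr0 [_ *: 1]mulr1.
have -> : v - h^-1 *: (g h - q) = (h^-1 * s h) *: w.
  by apply/rowP => i; rewrite !mxE; field.
rewrite normrZ normrM normfV -mulrA ler_pdivrMl ?normr_gt0//.
apply: le_trans (_ : e / (1 + `|w|) * `|h| * (1 + `|w|) <= _).
  by apply: ler_pM => //; rewrite lerDr.
by rewrite mulrAC divfK ?gt_eqF ?ltr_pwDl// mulrC.
Unshelve. all: by end_near. Qed.

Lemma reeb_tangent_hyperplane Q q n :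
  (forall v, tangent Q q v <-> inner v n = 0) -> 0 < inner q n ->
  reeb Q q = (inner q n)^-1 *: Jc n.
Proof.
move=> Qn qn; set r := _ *: _.
have r_reeb : is_reeb Q q r.
  rewrite /r; split => [v /Qn vn|]; rewrite /omega innerZr inner_Jc.
    by rewrite vn mulr0.
  by rewrite mulVf// gt_eqF.
have [r_tangent r_q] := r_reeb.
have [reeb_tangent reeb_q] : is_reeb Q q (reeb Q q) by apply: xgetPex; exists r.
apply/subr0_eq; set w := _ - _.
have Jw v : inner (Jc v) w = 0.
  pose e := inner v n / inner q n.
  have tv : tangent Q q (v - e *: q).
    by apply/Qn; rewrite !innerE /e divfK ?subrr// gt_eqF.
  move: reeb_q r_q (reeb_tangent _ tv) (r_tangent _ tv).
  by rewrite /omega /w !(JcE, innerE) => -> ->; lra.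
by apply: inner_eq0; have := Jw (- Jc w); rewrite JcN JcK opprK.
Qed.

Section SmoothPoint.
Variables (D : set (vec R d)) (q n : vec R d).
Hypotheses (cD : closed D) (convD : convex_set D) (D0 : interior D 0).
Hypothesis smooth_q : smooth_point D q n.

Lemma smooth_point_inner_gt0 : 0 < inner q n.
Proof. by have [_ n0 qn _] := smooth_q; exact: outer_normal_inner_gt0 qn n0. Qed.

Lemma smooth_point_tangent_room v (e : R) : inner v n = 0 -> 0 < e ->
  \forall t \near (0 : R), D (q + t *: v - (e * `|t|) *: q).
Proof.
have [Dq _ _ feas] := smooth_q => vn e0.
have inward u : inner u n = 0 -> feasible D q (u - e *: q).
  move=> un; apply: feas; rewrite !innerE un.
  by have := mulr_gt0 e0 smooth_point_inner_gt0; lra.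
have right_room : \forall t \near (0 : R), 0 < t -> D (q + t *: (v - e *: q)).
  exact: inward.
have left_room : \forall t \near (0 : R),
    0 < - t -> D (q + (- t) *: (- v - e *: q)).
  have /nearN : \forall t \near (- 0 : R), 0 < t -> D (q + t *: (- v - e *: q)).
    by rewrite oppr0; apply: inward; rewrite innerNl vn oppr0.
  exact.
near=> t; have [t0|t0|->] := ltgtP t 0.
- have -> : q + t *: v - (e * `|t|) *: q = q + (- t) *: (- v - e *: q).
    by rewrite ltr0_norm//; apply/rowP => i; rewrite !mxE; ring.
  by move: t0; rewrite -oppr_gt0; near: t.
- have -> : q + t *: v - (e * `|t|) *: q = q + t *: (v - e *: q).
    by rewrite gtr0_norm//; apply/rowP => i; rewrite !mxE; ring.
  by move: t0; near: t.
- by rewrite normr0 mulr0 !scale0r subr0 addr0.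
Unshelve. all: by end_near. Qed.

(* The curve is [q + t *: v], moved back to the boundary along [q]. *)
Lemma smooth_point_tangent v : inner v n = 0 -> tangent (boundary D) q v.
Proof.
have [_ n0 qn _] := smooth_q => vn.
have crossing t : exists s, interior D (t *: v) ->
    0 <= s <= 1 /\ boundary D (q + t *: v - s *: q).
  have [Dtv|] := pselect (interior D (t *: v)); last by exists 0.
  have [|s /andP[s0 s1] bs] := @segment_meets_boundary D (t *: v) (q + t *: v) cD Dtv.
    move=> /(outer_normal_interior_lt qn n0).
    by rewrite innerDl innerZl vn mulr0 addr0 ltxx.
  exists (1 - s) => _; split; first by lra.
  have -> // : q + t *: v - (1 - s) *: q = t *: v + s *: (q + t *: v - t *: v).
  by apply/rowP => i; rewrite !mxE; ring.
have [s sP] := choice crossing.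
have Dtv : \forall t \near (0 : R), interior D (t *: v).
  have /(near_line v) := nbhs_interior D0.
  by apply: filterS => t; rewrite add0r.
apply: (@small_correction_tangent _ _ q _ s) => [|e e0].
  by apply: filterS Dtv => t /sP[].
near=> t; have int_tv : interior D (t *: v) by near: t.
have [/andP[s0 s1] /boundary_closed-/(_ cD)[_ nint]] := sP t int_tv.
have room : D (q + t *: v - (e * `|t|) *: q).
  by near: t; exact: smooth_point_tangent_room.
rewrite (ger0_norm s0) leNgt; apply/negP => es; apply: nint.
have e1 : 0 < 1 - e * `|t| by lra.
have -> : q + t *: v - s t *: q = t *: v +
    ((1 - s t) / (1 - e * `|t|)) *: (q + t *: v - (e * `|t|) *: q - t *: v).
  by apply/rowP => i; rewrite !mxE; field; rewrite gt_eqF.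
apply: (convex_interior_segment convD int_tv room); apply/andP; split.
  by apply: divr_ge0; lra.
by rewrite ltr_pdivrMr ?mul1r; lra.
Unshelve. all: by end_near. Qed.

Lemma tangent_smooth_pointP v : tangent (boundary D) q v <-> inner v n = 0.
Proof.
have [_ _ qn _] := smooth_q.
by split; [exact: outer_normal_tangent | exact: smooth_point_tangent].
Qed.

Lemma reeb_smooth_point : reeb (boundary D) q = (inner q n)^-1 *: Jc n.
Proof.
exact: reeb_tangent_hyperplane tangent_smooth_pointP smooth_point_inner_gt0.
Qed.

Lemma smooth_point_normal_unique m : outer_normal D q m -> m != 0 ->
  exists2 b : R, 0 < b & m = b *: n.
Proof.
have [_ n0 _ _] := smooth_q => qm m0; pose b := inner m n / inner n n.
have wn : inner (m - b *: n) n = 0.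
  by rewrite !innerE divfK ?subrr// gt_eqF// inner_gt0.
have wm : inner (m - b *: n) m = 0.
  by apply: outer_normal_tangent cD qm _; exact/tangent_smooth_pointP.
have mE : m = b *: n.
  by apply/subr0_eq/inner_eq0; rewrite innerDr innerNr innerZr wn wm mulr0 subr0.
exists b => //; have := outer_normal_inner_gt0 D0 qm m0.
by rewrite mE innerZr pmulr_lgt0// smooth_point_inner_gt0.
Qed.

Lemma smooth_point_outer_normal m : outer_normal D q m -> m != 0 ->
  smooth_point D q m.
Proof.
have [Dq _ _ feas] := smooth_q => qm m0.
have [b b0 mE] := smooth_point_normal_unique qm m0.
by split => // u um; apply: feas; move: um; rewrite mE innerZr pmulr_rlt0.
Qed.

Lemma polar_gauge_smooth_point (H : vec R d -> R) :
  (forall t x, 0 < t -> H (t *: x) = t * H x) ->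
  sympl_polar (boundary D) = [set x | H x = 1] -> H (Jc n) = inner q n.
Proof.
have [Dq n0 qn _] := smooth_q => H_homog H_polar.
have q0 := smooth_point_inner_gt0.
have : [set x | H x = 1] (reeb (boundary D) q).
  by rewrite -H_polar; exists q => //; exact: outer_normal_boundary qn.
rewrite reeb_smooth_point /= H_homog ?invr_gt0// => /(congr1 ( *%R (inner q n))).
by rewrite mulVKf ?gt_eqF// mulr1.
Qed.

End SmoothPoint.

End ConvexSets.

Section DifferenceBody.
Variables (R : realType) (d : nat).
Implicit Types (K : set (vec R d)) (a b n u : vec R d).

Lemma support_point_exists K u : compact K -> K !=set0 ->
  exists a, K a /\ outer_normal K a u.
Proof.
move=> cptK K_neq0.
have [|a Ka aP] := compact_EVT_max (f := fun y : vec R d => inner y u) K_neq0 cptK.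
  by apply: continuous_subspaceT; exact: inner_continuous.
exists a; split; first by rewrite inE in Ka.
by move=> y Ky; apply: aP; rewrite inE.
Qed.

Lemma diff_body_compact K : compact K -> compact (diff_body K).
Proof.
move=> cptK; have -> : diff_body K = [set p.1 - p.2 | p in K `*` K].
  apply/seteqP; split => y /=.
    by move=> [a Ka [b Kb <-]]; exists (a, b).
  by move=> [[a b] [Ka Kb] <-]; exists a => //; exists b.
apply: continuous_compact (compact_setX cptK cptK).
by apply: continuous_subspaceT => p; apply: cvgB; [exact: cvg_fst | exact: cvg_snd].
Qed.

Lemma diff_body_convex K : convex_set K -> convex_set (diff_body K).
Proof.
move=> convK; apply: segment_convex => _ _ t [a Ka [b Kb <-]] [a' Ka' [b' Kb' <-]] t01.
exists (a + t *: (a' - a)); first exact: convex_segment.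
exists (b + t *: (b' - b)); first exact: convex_segment.
by apply/rowP => i; rewrite !mxE; ring.
Qed.

Lemma diff_body_interior0 K : interior K 0 -> interior (diff_body K) 0.
Proof.
move=> K0; apply: (interiorS _ K0) => a Ka; exists a => //.
by exists 0; [exact: interior_subset | exact: subr0].
Qed.

Lemma diff_body_outer_normal K a b n : outer_normal K a n ->
  outer_normal K b (- n) -> outer_normal (diff_body K) (a - b) n.
Proof.
move=> an bn _ [a' Ka' [b' Kb' <-]]; have := an _ Ka'; have := bn _ Kb'.
by rewrite !innerE; lra.
Qed.

Lemma diff_body_smooth_point K a b n : smooth_point K a n -> K b ->
  outer_normal K b (- n) -> smooth_point (diff_body K) (a - b) n.
Proof.
move=> [Ka n0 an feas] Kb bn; split => //; first by exists a => //; exists b.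
  exact: diff_body_outer_normal.
move=> u /feas; apply: filterS => t Kat; exists (a + t *: u) => //; exists b => //.
by rewrite addrAC.
Qed.

End DifferenceBody.

Definition smooth_body (R : realType) (d : nat) (K : set (vec R d)) :=
  forall m, boundary K m -> exists n, smooth_point K m n.

Definition quadratic_gap (R : realType) (d : nat) (K : set (vec R d))
    (F : vec R d -> R) (kap : R) (m y : vec R d) :=
  boundary K m -> boundary K y ->
  kap * `|grad F m| * `|m - y| ^+ 2 <= inner (m - y) (grad F m).

Definition uniformly_convex_body (R : realType) (d : nat) (K : set (vec R d))
    (kap : R) :=
  forall m n y, boundary K m -> outer_normal K m n -> boundary K y ->
  kap * `|n| * `|m - y| ^+ 2 <= inner (m - y) n.

Definition lipschitz_support (R : realType) (d : nat) (K : set (vec R d)) (L : R) :=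
  forall a b u w, K a -> K b -> outer_normal K a u -> outer_normal K b w ->
  `|a - b| * `|u| <= L * `|u - w|.

Section LevelSetBody.
Variables (R : realType) (d : nat) (K U : set (vec R d)) (F : vec R d -> R) (c : R).
Hypotheses (closedK : closed K) (convK : convex_set K) (K0 : interior K 0).
Hypotheses (oU : open U) (sF : smooth_on U F).
Hypothesis posF : forall x, U x -> hessian_posdef F x.
Hypothesis bdE : boundary K = [set q | U q /\ F q = c].
Implicit Types m n y z : vec R d.

Lemma boundary_strongly_convex_near m : boundary K m ->
  exists k r : R, [/\ 0 < k, 0 < r & strongly_convex_on (ball m r) F k].
Proof.
by rewrite bdE => -[Um _]; exact: strongly_convex_near oU sF Um (posF Um).
Qed.

Lemma boundary_strongly_below_grad m y (B : set (vec R d)) (k : R) :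
  strongly_convex_on B F k -> B m -> B y -> boundary K m -> boundary K y ->
  k * `|m - y| ^+ 2 <= inner (m - y) (grad F m).
Proof.
move=> convF Bm By; rewrite bdE => -[_ Fm] [_ Fy]; have := convF _ _ Bm By.
by rewrite Fm Fy (distrC y) innerC -[y - m]opprB innerNl; lra.
Qed.

Lemma boundary_below_grad_near m : boundary K m -> \forall y \near m,
  boundary K y -> y != m -> inner y (grad F m) < inner m (grad F m).
Proof.
move=> bm; have [k [r [k0 r0 convF]]] := boundary_strongly_convex_near bm.
have : nbhs m (ball m r) by exact: nbhsx_ballx.
apply: filterS => y By bdy ym.
have := boundary_strongly_below_grad convF (ballxx m r0) By bm bdy.
have : 0 < k * `|m - y| ^+ 2.
  by rewrite mulr_gt0// exprn_gt0// normr_gt0 subr_eq0 eq_sym.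
by rewrite innerDl innerNl; lra.
Qed.

Lemma grad_neq0 m : boundary K m -> grad F m != 0.
Proof.
move=> bm; apply/eqP => gm.
apply: (boundary_not_isolated closedK convK K0 bm).
apply: filterS (boundary_below_grad_near bm) => y below /below.
by rewrite gm !inner0r ltxx; case: eqVneq => // _ /(_ isT).
Qed.

Lemma grad_outer_normal m : boundary K m -> outer_normal K m (grad F m).
Proof.
move=> bm; have below := boundary_below_grad_near bm.
by apply: local_outer_normal bm (grad_neq0 bm) below => //; exists 0.
Qed.

(* At a boundary point [b] between an interior point [p] and [z], the gradient
   increases from [p] to [z], hence [F z >= F b = c] by convexity. *)
Lemma sublevel_interior_near m : boundary K m ->
  \forall z \near m, F z < c -> interior K z.
Proof.
move=> bm; have [Km _] := (boundary_closed m closedK).1 bm.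
have [k [r [k0 r0 convF]]] := boundary_strongly_convex_near bm.
have Bm := nbhsx_ballx m r r0.
near (0 : R)^'+ => t; have t0 : 0 < t by near: t; exact: nbhs_right_gt.
have t1 : t < 1 by near: t; exact: nbhs_right_lt.
pose p := m + t *: (0 - m).
have Bp : ball m r p by rewrite /p; near: t; apply: cvg_within; exact: near_line.
have Kp : interior K p.
  have -> : p = 0 + (1 - t) *: (m - 0) by apply/rowP => i; rewrite !mxE; ring.
  by apply: convex_interior_segment => //; lra.
apply: filterS (nbhsx_ballx m r r0) => z Bz Fz; apply: contrapT.
move=> /(segment_meets_boundary closedK Kp)[s /andP[s0 s1] bb].
set b := p + s *: (z - p) in bb.
have Bb : ball m r b by apply: ball_segment => //; rewrite (ltW s0).
have pb := outer_normal_interior_lt (grad_outer_normal bb) (grad_neq0 bb) Kp.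
have gzp : 0 < inner (grad F b) (z - p).
  rewrite -(pmulr_rgt0 _ s0) -innerZr innerC.
  have -> : s *: (z - p) = b - p by rewrite /b [p + _]addrC addrK.
  by rewrite innerDl innerNl subr_gt0.
have [_ Fb] : U b /\ F b = c by move: bb; rewrite bdE.
have := convF _ _ Bb Bz; rewrite Fb.
have -> : z - b = (1 - s) *: (z - p) by apply/rowP => i; rewrite !mxE; ring.
have k_ge0 : 0 <= k * `|(1 - s) *: (z - p)| ^+ 2 by rewrite mulr_ge0 ?exprn_ge0// ltW.
have := mulr_ge0 (_ : 0 <= 1 - s) (ltW gzp); rewrite subr_ge0 s1 => /(_ isT).
by rewrite innerZr; lra.
Unshelve. all: by end_near. Qed.

Lemma grad_smooth_point m : boundary K m -> smooth_point K m (grad F m).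
Proof.
move=> bm; have [Km _] := (boundary_closed m closedK).1 bm.
have [Um Fm] : U m /\ F m = c by move: bm; rewrite bdE.
have dF : differentiable F m := smooth_on_differentiable sF Um.
split => //; [exact: grad_neq0 | exact: grad_outer_normal | move=> u um].
have decr : \forall t \near (0 : R)^'+, F (m + t *: u) < c.
  rewrite -Fm; apply: derive_lt0_near; first exact: diff_derivable.
  by rewrite derive_grad// innerC.
near=> t; apply: interior_subset.
have : F (m + t *: u) < c by near: t.
near: t; apply: cvg_within; exact: near_line (sublevel_interior_near bm).
Unshelve. all: by end_near. Qed.

Lemma level_set_smooth_body : smooth_body K.
Proof. by move=> m bm; exists (grad F m); exact: grad_smooth_point. Qed.

Lemma grad_exposes m y : boundary K m -> K y -> y != m ->
  inner y (grad F m) < inner m (grad F m).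
Proof.
move=> bm Ky ym; rewrite lt_neqAle grad_outer_normal// andbT; apply/eqP => ymE.
have [Km _] := (boundary_closed m closedK).1 bm.
near (0 : R)^'+ => t; have t0 : 0 < t by near: t; exact: nbhs_right_gt.
pose z := m + t *: (y - m).
have zE : inner z (grad F m) = inner m (grad F m).
  by rewrite !innerE ymE subrr mulr0 addr0.
have Kz : K z.
  apply: convex_segment => //; rewrite ltW//=.
  by near: t; apply: nbhs_right_le.
have bz : boundary K z.
  apply: outer_normal_boundary (grad_neq0 bm) _ => // x.
  by rewrite zE; exact: grad_outer_normal.
have : boundary K z -> z != m -> inner z (grad F m) < inner m (grad F m).
  rewrite /z; near: t; apply: cvg_within.
  exact: near_line (boundary_below_grad_near bm).
rewrite zE ltxx -subr_eq0 addrC addKr scaler_eq0 gt_eqF// subr_eq0.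
by move=> /(_ bz ym).
Unshelve. all: by end_near. Qed.

Lemma boundary_compact : bounded_set K -> compact (boundary K).
Proof.
move=> bK; have -> : boundary K = K `&` ~` (interior K).
  by apply/seteqP; split => y; rewrite boundary_closed.
apply: (subclosed_compact _ (bounded_closed_compact bK closedK)) => [|y []//].
by apply: closedI => //; apply: open_closedC; exact: open_interior.
Qed.

Section QuadraticGapNear.
Variables (T : Type) (G : set_system T) (mu nu : T -> vec R d) (kap : T -> R).
Variables (m y : vec R d).
Context {FG : Filter G}.
Hypotheses (mu_cvg : mu q @[q --> G] --> m) (nu_cvg : nu q @[q --> G] --> y).
Hypothesis kap_cvg : kap q @[q --> G] --> (0 : R).
Hypothesis bm : boundary K m.

Let grad_cvg : grad F (mu q) @[q --> G] --> grad F m.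
Proof.
have Um : U m by move: bm; rewrite bdE => -[].
exact: (cvg_comp _ _ mu_cvg (grad_continuous sF Um)).
Qed.

Lemma quadratic_gap_near_diagonal : m = y ->
  \forall q \near G, quadratic_gap K F (kap q) (mu q) (nu q).
Proof.
move=> my; have [k [r [k0 r0 convF]]] := boundary_strongly_convex_near bm.
have Bm : nbhs m (ball m r) by exact: nbhsx_ballx.
have kg_cvg : kap q * `|grad F (mu q)| @[q --> G] --> (0 : R).
  rewrite -[X in _ --> X](mul0r `|grad F m|).
  exact: cvgM kap_cvg (cvg_norm grad_cvg).
have small_kg : \forall q \near G, kap q * `|grad F (mu q)| < k.
  exact: (cvgr_lt _ kg_cvg).
have near_mu : \forall q \near G, ball m r (mu q) by exact: (mu_cvg Bm).
have near_nu : \forall q \near G, ball m r (nu q).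
  by apply: (nu_cvg (_ : nbhs y _)); rewrite -my.
apply: filterS3 small_kg near_mu near_nu => q kq Bmu Bnu bmu bnu.
apply: le_trans (boundary_strongly_below_grad convF Bmu Bnu bmu bnu).
by rewrite ler_wpM2r ?exprn_ge0 ?(ltW kq).
Qed.

Lemma quadratic_gap_near_distinct : K y -> y != m ->
  \forall q \near G, quadratic_gap K F (kap q) (mu q) (nu q).
Proof.
move=> Ky ym; have gap : 0 < inner (m - y) (grad F m).
  by rewrite innerDl innerNl subr_gt0; exact: grad_exposes.
pose f q := inner (mu q - nu q) (grad F (mu q)) -
  kap q * `|grad F (mu q)| * `|mu q - nu q| ^+ 2.
have f_cvg : f q @[q --> G] --> inner (m - y) (grad F m).
  have d_cvg : mu q - nu q @[q --> G] --> m - y by exact: cvgB.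
  rewrite -[X in _ --> X]subr0 -(mul0r (`|m - y| ^+ 2)) -(mul0r `|grad F m|).
  apply: cvgB; first exact: cvg_inner d_cvg grad_cvg.
  apply: cvgM; first exact: cvgM kap_cvg (cvg_norm grad_cvg).
  by apply: cvgM; exact: cvg_norm.
have : \forall q \near G, 0 < f q by exact: (cvgr_gt _ f_cvg).
by apply: filterS => q f0 _ _; rewrite -subr_ge0 ltW.
Qed.

End QuadraticGapNear.

Lemma quadratic_gap_uniform : bounded_set K ->
  exists2 kap : R, 0 < kap & forall m y, quadratic_gap K F kap m y.
Proof.
move=> bK; have cptb := boundary_compact bK.
have gap : \forall kap \near (0 : R)^'+,
    boundary K `*` boundary K `<=` [set p | quadratic_gap K F kap p.1 p.2].
  have /compact_near_coveringP := compact_setX cptb cptb.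
  apply=> -[m y] [/= bm b_y]; pose G := filter_prod (nbhs (m, y)) ((0 : R)^'+).
  have mu_cvg : q.1.1 @[q --> G] --> m.
    exact: (cvg_comp fst fst (@cvg_fst _ _ _ _ _) (@cvg_fst _ _ (nbhs m) (nbhs y) _)).
  have nu_cvg : q.1.2 @[q --> G] --> y.
    exact: (cvg_comp fst snd (@cvg_fst _ _ _ _ _) (@cvg_snd _ _ (nbhs m) (nbhs y) _)).
  have kap_cvg : q.2 @[q --> G] --> (0 : R).
    by apply: (cvg_trans (@cvg_snd _ _ _ _ _)); exact: cvg_within.
  have [my|my] := eqVneq m y.
    exact: (quadratic_gap_near_diagonal mu_cvg nu_cvg kap_cvg bm my).
  have [Ky _] := (boundary_closed y closedK).1 b_y; rewrite eq_sym in my.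
  exact: (quadratic_gap_near_distinct mu_cvg nu_cvg kap_cvg bm Ky my).
near (0 : R)^'+ => kap; exists kap; first by near: kap; exact: nbhs_right_gt.
have gap_kap : boundary K `*` boundary K `<=`
    [set p | quadratic_gap K F kap p.1 p.2] by near: kap.
by move=> m y bm b_y; exact: (gap_kap (m, y)).
Unshelve. all: by end_near. Qed.

Lemma level_set_uniformly_convex : bounded_set K ->
  exists2 kap : R, 0 < kap & uniformly_convex_body K kap.
Proof.
move=> /quadratic_gap_uniform[kap kap0 gap]; exists kap => // m n y bm mn b_y.
have [->|n0] := eqVneq n 0; first by rewrite normr0 mulr0 mul0r inner0r.
have [b b0 ->] :=
  smooth_point_normal_unique closedK convK K0 (grad_smooth_point bm) mn n0.
rewrite innerZr normrZ (gtr0_norm b0) [kap * _]mulrCA -!(mulrA b) ler_pM2l//.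
exact: gap.
Qed.

End LevelSetBody.

Lemma uniformly_convex_lipschitz_support (R : realType) (d : nat)
    (K : set (vec R d)) (rho kap : R) :
  closed K -> 0 < rho -> (forall y, K y -> `|y| <= rho) ->
  0 < kap -> uniformly_convex_body K kap ->
  lipschitz_support K (2 * rho + (d + d)%:R / kap).
Proof.
move=> closedK rho0 Krho kap0 convK a b u w Ka Kb au bw; set C := (d + d)%:R.
have C0 : 0 <= C / kap by rewrite divr_ge0// ltW.
have ab2 : `|a - b| <= 2 * rho.
  by apply: le_trans (ler_normB _ _) _; have := Krho _ Ka; have := Krho _ Kb; lra.
have [->|u0] := eqVneq u 0.
  by rewrite normr0 mulr0 mulr_ge0// addr_ge0// mulr_ge0// ltW.
have [->|w0] := eqVneq w 0.
  by rewrite subr0 ler_wpM2r//; lra.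
have [->|ab] := eqVneq a b.
  by rewrite subrr normr0 mul0r mulr_ge0// addr_ge0// mulr_ge0// ltW.
have ba := outer_normal_boundary closedK Ka u0 au.
have bb := outer_normal_boundary closedK Kb w0 bw.
have abw := bw _ Ka.
have upper : inner (a - b) u <= C * `|a - b| * `|u - w|.
  apply: le_trans (inner_le_normv _ _); apply: le_trans (ler_norm _).
  by rewrite !innerE; lra.
have gap : kap * (`|a - b| * `|u|) <= C * `|u - w|.
  have ab0 : 0 < `|a - b| by rewrite normr_gt0 subr_eq0.
  rewrite -(ler_pM2l ab0).
  by have := le_trans (convK _ _ _ ba au bb) upper; lra.
apply: le_trans (_ : C / kap * `|u - w| <= _).
  by rewrite mulrAC ler_pdivlMr// mulrC.
by rewrite ler_wpM2r// lerDr mulr_ge0// ltW.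
Qed.

(* [banach_fixed_point] needs completeness and norm joined on row vectors. *)
HB.instance Definition _ (R : realType) (n : nat) := Complete.on 'rV[R]_n.

Section OuterBilliard.
Variables (R : realType) (d : nat) (K : set (vec R d)) (rho L : R).
Hypotheses (cptK : compact K) (convK : convex_set K) (K0 : interior K 0).
Hypothesis smoothK : smooth_body K.
Hypotheses (L_gt0 : 0 < L) (lipK : lipschitz_support K L).
Hypotheses (rho_gt0 : 0 < rho) (Krho : forall y, K y -> `|y| <= rho).
Implicit Types a b m n u w x y z : vec R d.

Let closedK : closed K := compact_closed (@norm_hausdorff _ _) cptK.

Let K_neq0 : K !=set0. Proof. by exists 0; exact: interior_subset. Qed.

Local Notation T := (outer_billiard (boundary K)).
Local Notation tangency := (m_minus (boundary K)).

Lemma body_dist a b : K a -> K b -> `|a - b| <= 2 * rho.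
Proof.
move=> /Krho ar /Krho br; apply: le_trans (ler_normB _ _) _.
by rewrite mulr_natl mulr2n lerD.
Qed.

Lemma smooth_body_point a n : K a -> outer_normal K a n -> n != 0 ->
  smooth_point K a n.
Proof.
move=> Ka an n0; have ba := outer_normal_boundary closedK Ka n0 an.
have [g sg] := smoothK ba.
exact: (smooth_point_outer_normal closedK convK K0 sg an n0).
Qed.

(* A fixed point of [m |-> support point in the direction Jc (x - m)], which
   contracts once [x] is far away. *)
Lemma tangency_exists x : rho + 2 * L <= `|x| ->
  exists m, K m /\ outer_normal K m (Jc (x - m)).
Proof.
move=> x_far; have [q qP] := choice (fun u => support_point_exists u cptK K_neq0).
pose f m := q (Jc (x - m)).
have fK : {homo f : m / K m >-> K m} by move=> m _; exact: (qP _).1.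
have f_contr : is_contraction (mkfun fK : {fun K >-> K}).
  exists (2^-1)%:nng; split => /=; first by lra.
  move=> [m m'] /= [Km Km']; rewrite /self_sub /=.
  have := lipK (fK m Km) (fK m' Km') (qP _).2 (qP _).2.
  rewrite -/(f m) -/(f m') -JcN -JcD !normv_Jc.
  have -> : x - m - (x - m') = m' - m by rewrite opprB addrC subrKA.
  rewrite (distrC m') => fmm'.
  have xm : 2 * L <= `|x - m|.
    by have := lerB_dist x m; have := Krho Km; lra.
  rewrite -(ler_pM2l L_gt0).
  by have := ler_wpM2l (normr_ge0 (f m - f m')) xm; lra.
have [//|m Km fm] := banach_fixed_point f_contr closedK.
by exists m; split => //; rewrite {1}fm; exact: (qP _).2.
Qed.

(* Where there is no tangency point, [m_minus] is the default value 0. *)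
Lemma tangency_body x : K (tangency x).
Proof.
rewrite /m_minus; case: xgetP => [m _ [/boundary_closed-/(_ closedK)[]]//|_].
exact: interior_subset.
Qed.

Lemma tangency_outer_normal x : rho + 2 * L <= `|x| ->
  outer_normal K (tangency x) (Jc (x - tangency x)).
Proof.
move=> x_far; set m := tangency x.
have [bm [l l0 mE]] : boundary K m /\
    exists2 l : R, 0 < l & m - x = l *: reeb (boundary K) m.
  apply: (@xgetPex _ 0 [set m | boundary K m /\
    exists2 l : R, 0 < l & m - x = l *: reeb (boundary K) m]).
  have [p [Kp pn]] := tangency_exists x_far.
  have n0 : Jc (x - p) != 0.
    rewrite Jc_eq0 -normr_gt0; apply: lt_le_trans (lerB_dist x p).
    by have := Krho Kp; move: x_far L_gt0; lra.
  have sp := smooth_body_point Kp pn n0.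
  exists p; split; first exact: outer_normal_boundary pn.
  have q0 := smooth_point_inner_gt0 K0 sp.
  exists (inner p (Jc (x - p))) => //.
  rewrite (reeb_smooth_point closedK convK K0 sp) scalerA mulfV ?gt_eqF//.
  by rewrite scale1r JcK opprB.
have [n sn] := smoothK bm; have [_ _ mn _] := sn.
rewrite -opprB mE (reeb_smooth_point closedK convK K0 sn) scalerA JcN JcZ JcK.
rewrite scalerN opprK; apply: outer_normalZ mn.
by rewrite mulr_ge0 ?invr_ge0 ?ltW// (smooth_point_inner_gt0 K0 sn).
Qed.

Lemma billiard_sqrE x : T (T x) = x + 2 *: (tangency (T x) - tangency x).
Proof.
rewrite {1}/outer_billiard {2}/outer_billiard.
by apply/rowP => i; rewrite !mxE; ring.
Qed.

Lemma billiard_sqr_dist x : `|T (T x) - x| <= 4 * rho.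
Proof.
rewrite billiard_sqrE addrC addKr normrZ ger0_norm//.
by have := body_dist (tangency_body (T x)) (tangency_body x); lra.
Qed.

Section PolarGauge.
Variable H : vec R d -> R.
Hypothesis H_homog : forall (t : R) x, 0 < t -> H (t *: x) = t * H x.
Hypothesis H_polar : sympl_polar (symmetrization K) = [set x | H x = 1].

Lemma gauge_width x a b : K a -> K b -> outer_normal K a (Jc x) ->
  outer_normal K b (- Jc x) -> H x = inner (a - b) (Jc x).
Proof.
move=> Ka Kb ax bx; have [->|x0] := eqVneq x 0.
  have Jc0 : Jc (0 : vec R d) = 0 by rewrite -(scale0r 0) JcZ !scale0r.
  by have := @H_homog 2 0 (ltr0Sn _ 1); rewrite scaler0 Jc0 inner0r; lra.
have Jx0 : - Jc x != 0 by rewrite oppr_eq0 Jc_eq0.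
have cptD := diff_body_compact cptK.
have := polar_gauge_smooth_point (compact_closed (@norm_hausdorff _ _) cptD)
  (diff_body_convex convK) (diff_body_interior0 K0)
  (diff_body_smooth_point (smooth_body_point Kb bx Jx0) Ka _) H_homog H_polar.
by rewrite opprK JcN JcK opprK => ->//; rewrite !innerE; ring.
Qed.

Lemma gauge_subgradient x z a b : K a -> K b -> outer_normal K a (Jc x) ->
  outer_normal K b (- Jc x) -> inner (a - b) (Jc (z - x)) <= H z - H x.
Proof.
move=> Ka Kb ax bx; have [a' [Ka' az]] := support_point_exists (Jc z) cptK K_neq0.
have [b' [Kb' bz]] := support_point_exists (- Jc z) cptK K_neq0.
rewrite (gauge_width Ka Kb ax bx) (gauge_width Ka' Kb' az bz).
by have := az _ Ka; have := bz _ Kb; rewrite !(JcE, innerE); lra.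
Qed.

Let C : R := (d + d)%:R.
Let A : R := C * (2 * rho).

Lemma gauge_bounds x : 0 <= H x <= A * `|x|.
Proof.
have [a [Ka ax]] := support_point_exists (Jc x) cptK K_neq0.
have [b [Kb bx]] := support_point_exists (- Jc x) cptK K_neq0.
have K_origin := interior_subset K0.
rewrite (gauge_width Ka Kb ax bx); apply/andP; split.
  by have := ax _ K_origin; have := bx _ K_origin; rewrite !innerE; lra.
apply: le_trans (ler_norm _) _; apply: le_trans (inner_le_normv _ _) _.
by rewrite normv_Jc ler_wpM2r// /A /C ler_wpM2l// body_dist.
Qed.

(* As [inner (m2 - m1) (Jc (m2 - m1)) = 0], only the distance from [(m1, m2)] to
   the support points [(a, b)] of [Jc y] and [- Jc y] contributes. *)
Lemma gauge_drop_le y m1 m2 w1 w2 t r : K m1 -> K m2 -> outer_normal K m1 w1 ->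
  outer_normal K m2 w2 -> `|Jc y - w1| <= r -> `|- Jc y - w2| <= r ->
  (H y - H (y + t *: (m2 - m1))) * `|y| <= `|t| * (A * (2 * L * r)).
Proof.
move=> Km1 Km2 mw1 mw2 yw1 yw2; set D := m2 - m1.
have [a [Ka ay]] := support_point_exists (Jc y) cptK K_neq0.
have [b [Kb b_y]] := support_point_exists (- Jc y) cptK K_neq0.
pose e := (a - m1) - (b - m2).
have drop : H y - H (y + t *: D) <= `|t| * `|inner e (Jc D)|.
  have := gauge_subgradient (y + t *: D) Ka Kb ay b_y.
  rewrite [y + _]addrC addrK JcZ innerZr.
  have -> : a - b = e - D by rewrite /e /D; apply/rowP => i; rewrite !mxE; ring.
  rewrite innerDl innerNl inner_Jc_self subr0 -normrM => sub.
  by have := ler_norm (- (t * inner e (Jc D))); rewrite normrN; lra.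
have e_small : `|e| * `|y| <= 2 * L * r.
  have ay_lip := lipK Ka Km1 ay mw1; have by_lip := lipK Kb Km2 b_y mw2.
  rewrite ?normrN normv_Jc in ay_lip by_lip.
  have := ler_wpM2r (normr_ge0 y) (ler_normB (a - m1) (b - m2)); rewrite -/e.
  have := ler_wpM2l (ltW L_gt0) yw1; have := ler_wpM2l (ltW L_gt0) yw2; lra.
have pairing : `|inner e (Jc D)| <= A * `|e|.
  apply: le_trans (inner_le_normv _ _) _; rewrite normv_Jc mulrAC /A /C.
  by rewrite ler_wpM2r// ler_wpM2l// body_dist.
apply: le_trans (ler_wpM2r (normr_ge0 y) drop) _; rewrite -(mulrA `|t|) ler_wpM2l//.
apply: le_trans (ler_wpM2r (normr_ge0 y) pairing) _; rewrite -(mulrA A) ler_wpM2l//.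
by rewrite !mulr_ge0// ltW.
Qed.

Let far : R := 8 * rho + 2 * L.
Let drift : R := A * (2 * L * (3 * rho)).

Lemma billiard_sqr_tangency_normals x : far <= `|x| ->
  outer_normal K (tangency x) (Jc (x - tangency x)) /\
  outer_normal K (tangency (T x)) (Jc (T x - tangency (T x))).
Proof.
rewrite /far => x_far; have r0 := rho_gt0.
split; apply: tangency_outer_normal; first by lra.
have := lerB_dist x (2 *: tangency x); have := Krho (tangency_body x).
by rewrite distrC normrZ ger0_norm// /outer_billiard; lra.
Qed.

Lemma body_sub_double a b : K a -> K b -> `|a - 2 *: b| <= 3 * rho.
Proof.
move=> /Krho ar /Krho br; apply: le_trans (ler_normB _ _) _.
by rewrite normrZ ger0_norm//; lra.
Qed.

Lemma gauge_fall_far x : far <= `|x| ->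
  (H x - H (T (T x))) * `|x| <= 2 * drift.
Proof.
move=> /billiard_sqr_tangency_normals[]; rewrite (billiard_sqrE x).
move: (tangency_body x) (tangency_body (T x)).
set m1 := tangency x; set m2 := tangency (T x) => Km1 Km2 m1n m2n.
have := @gauge_drop_le x m1 m2 _ _ 2 (3 * rho) Km1 Km2 m1n m2n.
rewrite ger0_norm//; apply.
  rewrite -JcN -JcD normv_Jc opprB addrC subrK.
  by have := Krho Km1; move: rho_gt0; lra.
rewrite -!JcN -JcD normv_Jc.
have -> : - x - (T x - m2) = m2 - 2 *: m1.
  by apply/rowP => i; rewrite !mxE; ring.
exact: body_sub_double.
Qed.

Lemma gauge_rise_far x : far <= `|x| ->
  (H (T (T x)) - H x) * `|T (T x)| <= 2 * drift.
Proof.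
move=> /billiard_sqr_tangency_normals[]; have := billiard_sqrE x.
move: (T (T x)) (tangency_body x) (tangency_body (T x)) => x'.
set m1 := tangency x; set m2 := tangency (T x) => Km1 Km2 x'E m1n m2n.
have := @gauge_drop_le x' m1 m2 _ _ (- 2) (3 * rho) Km1 Km2 m1n m2n.
have -> : x' + (- 2) *: (m2 - m1) = x by rewrite x'E scaleNr addrK.
rewrite normrN ger0_norm//; apply.
  rewrite -JcN -JcD normv_Jc -normrN.
  have -> : - (x' - (x - m1)) = m1 - 2 *: m2.
    by rewrite x'E; apply/rowP => i; rewrite !mxE; ring.
  exact: body_sub_double.
rewrite -!JcN -JcD normv_Jc.
have -> : - x' - (T x - m2) = - m2.
  by rewrite x'E; apply/rowP => i; rewrite !mxE; ring.
by rewrite normrN; have := Krho Km2; move: rho_gt0; lra.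
Qed.

Lemma gauge_drift_far x : far <= `|x| ->
  `|H (T (T x)) - H x| * `|x| <= 4 * drift.
Proof.
move=> x_far; have fall := gauge_fall_far x_far; have rise := gauge_rise_far x_far.
have x'x : `|x| <= 2 * `|T (T x)|.
  have := lerB_dist x (x - T (T x)); rewrite subKr (distrC x).
  by have := billiard_sqr_dist x; move: x_far rho_gt0 L_gt0; rewrite /far; lra.
have [up|down] := leP 0 (H (T (T x)) - H x).
  by rewrite ger0_norm//; have := ler_wpM2l up x'x; lra.
have drift0 : 0 <= drift by rewrite !mulr_ge0// ltW.
by rewrite ltr0_norm// opprB; lra.
Qed.

Lemma gauge_sqr_drift_far x : far <= `|x| ->
  `|H (T (T x)) ^+ 2 - H x ^+ 2| <= 3 * A * (4 * drift).
Proof.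
move=> x_far; have /andP[H0 Hx] := gauge_bounds x.
have /andP[H0' Hx'] := gauge_bounds (T (T x)).
have A0 : 0 <= A by rewrite !mulr_ge0// ltW.
have x'x : `|T (T x)| <= 2 * `|x|.
  have := ler_normD (T (T x) - x) x; rewrite subrK; have := billiard_sqr_dist x.
  by move: x_far rho_gt0 L_gt0; rewrite /far; lra.
have sum_le : H (T (T x)) + H x <= 3 * A * `|x| by have := ler_wpM2l A0 x'x; lra.
rewrite subr_sqr normrM [X in _ * X]ger0_norm ?addr_ge0//.
apply: le_trans (ler_wpM2l (normr_ge0 _) sum_le) _.
by rewrite [leLHS]mulrCA; apply: ler_wpM2l (gauge_drift_far x_far); rewrite mulr_ge0.
Qed.

Lemma gauge_sqr_drift_near x : `|x| <= far ->
  `|H (T (T x)) ^+ 2 - H x ^+ 2| <= (A * (far + 4 * rho)) ^+ 2.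
Proof.
move=> x_near; have A0 : 0 <= A by rewrite !mulr_ge0// ltW.
have r0 := rho_gt0.
have x'_near : `|T (T x)| <= far + 4 * rho.
  have := ler_normD (T (T x) - x) x; rewrite subrK; have := billiard_sqr_dist x.
  by lra.
have sqr_le z : `|z| <= far + 4 * rho -> 0 <= H z ^+ 2 <= (A * (far + 4 * rho)) ^+ 2.
  have /andP[Hz Hz'] := gauge_bounds z => zf; rewrite exprn_ge0//=.
  have HB : H z <= A * (far + 4 * rho) := le_trans Hz' (ler_wpM2l A0 zf).
  by rewrite ler_sqr ?nnegrE// (le_trans Hz).
have /andP[x'0 x'B] := sqr_le _ x'_near.
have /andP[x0 xB] : 0 <= H x ^+ 2 <= (A * (far + 4 * rho)) ^+ 2.
  by apply: sqr_le; lra.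
by rewrite ler_norml; apply/andP; split; lra.
Qed.

Lemma gauge_sqr_iter : exists2 Cb : R, 0 < Cb & forall x k,
  `|H (iter (2 * k) T x) ^+ 2 - H x ^+ 2| <= Cb * k%:R.
Proof.
pose E : R := 3 * A * (4 * drift).
pose B : R := (A * (far + 4 * rho)) ^+ 2.
have A0 : 0 <= A by rewrite !mulr_ge0// ltW.
have E0 : 0 <= E by rewrite !mulr_ge0// ltW.
have B0 : 0 <= B by rewrite sqr_ge0.
exists (E + B + 1) => [|x k]; first by lra.
rewrite mulnC iterM; apply: (iter_dist_le (f := fun y => H y ^+ 2)) => y /=.
have [y_far|/ltW y_near] := leP far `|y|.
  by have := gauge_sqr_drift_far y_far; rewrite -/E; lra.
by have := gauge_sqr_drift_near y_near; rewrite -/B; lra.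
Qed.

End PolarGauge.

End OuterBilliard.

Theorem theorem3p5 (R : realType) (d : nat)
    (M K : set (vec R d)) (U : set (vec R d)) (F : vec R d -> R) (c : R)
    (H : vec R d -> R) :
  (* K is the (closed) domain bounded by M *)
  closed K -> bounded_set K -> convex_set K ->
  (* strict convexity *)
  (forall a b : vec R d, K a -> K b -> a != b -> forall t : R, 0 < t -> t < 1 ->
      interior K (t *: a + (1 - t) *: b)) ->
  interior K 0 ->
  M = boundary K ->
  (* M is a level set of a smooth function with positive definite Hessian *)
  open U -> M `<=` U -> smooth_on U F -> (forall x, U x -> hessian_posdef F x) ->
  M = [set q | U q /\ F q = c] ->
  (* H is the positively 1-homogeneous function with N = {H = 1},
     N the symplectic polar of the symmetrization of M *)
  (forall (t : R) (x : vec R d), 0 < t -> H (t *: x) = t * H x) ->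
  sympl_polar (symmetrization K) = [set x | H x = 1] ->
  exists2 Lam : R, 0 < Lam & exists2 Cb : R, 0 < Cb &
    forall x : vec R d, Lam <= H x -> forall k : nat, (1 <= k)%N ->
      `| H (iter (2 * k) (outer_billiard M) x) ^+ 2 - H x ^+ 2 | <= Cb * k%:R.
Proof.
move=> closedK boundedK convK _ K0 -> oU _ sF posF bdE H_homog H_polar.
have cptK := bounded_closed_compact boundedK closedK.
have smoothK := level_set_smooth_body closedK convK K0 oU sF posF bdE.
have [kap kap_gt0 unifK] :=
  level_set_uniformly_convex closedK convK K0 oU sF posF bdE boundedK.
have [rho rho_gt0 Krho] := pinfty_ex_gt0 boundedK.
have lipK := uniformly_convex_lipschitz_support closedK rho_gt0 Krho kap_gt0 unifK.
have L_gt0 : 0 < 2 * rho + (d + d)%:R / kap.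
  by rewrite ltr_pwDl ?mulr_gt0// divr_ge0// ltW.
have [Cb Cb_gt0 H_iter] := gauge_sqr_iter cptK convK K0 smoothK L_gt0 lipK
  rho_gt0 Krho H_homog H_polar.
by exists 1 => //; exists Cb => // x _ k _; exact: H_iter.
Qed.
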